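(* Let $N\ge 1$ and, for each $i=1,\dots,N$, let $A_i\in\mathbb{R}^{n_i\times n_i}$, $C_i\in\mathbb{R}^{p_i\times n_i}$, $Q_i\succ 0$, $R_i\succ 0$ with $(A_i,Q_i^{1/2})$ controllable and $(A_i,C_i)$ detectable. Let $\mu_d$ be the optimal value of the deterministic scheduling problem and $\mu_s$ the optimal value of the stochastic scheduling problem, both defined in the context. If $A_i$ is invertible for every $i=1,\dots,N$, then the deterministic scheduling performance $\mu_d$ is almost surely upper bounded by the stochastic scheduling performance $\mu_s$, i.e. $\mu_d\le \mu_s$.
   Context: Setting: $N$ independent linear systems $x_i[k+1]=A_ix_i[k]+w_i[k]$, where $w_i[k]$ is independent zero-mean Gaussian noise with covariance $Q_i\succ0$ and $x_i[0]$ is an independent zero-mean Gaussian with covariance $\pi_i[0]\succeq 0$. The observation is $\tilde y_i[k]=\xi_i[k](C_ix_i[k]+v_i[k])$, $v_i[k]$ independent zero-mean Gaussian noise with covariance $R_i\succ 0$, and $\xi_i[k]\in\{0,1\}$ indicates whether system $i$ is observed at time $k$; exactly one system is observed at each time, i.e. $\sum_{i=1}^N\xi_i[k]=1$ for all $k$. Error covariance: for a given sequence $\{\xi_i[j]\}$, the (one-step prediction) Kalman filter error covariance $P_i[k]=P_i[k|k-1]$ evolves by $$P_i[k+1]=A_iP_i[k]A_i'+Q_i-\xi_i[k]\,A_iP_i[k]C_i'(C_iP_i[k]C_i'+R_i)^{-1}C_iP_i[k]A_i',\qquad (\ast)$$ started from $P_i[1]=A_i\pi_i[0]A_i'+Q_i$.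 Here $'$ denotes transpose. Deterministic scheduling problem: $$\mu_d=\min_{\{\xi_i[j]\}_{j=1}^\infty,\ i=1,\dots,N}\ \max_i\Big(\limsup_{T\to\infty}\frac1T\sum_{k=1}^T \mathrm{Tr}(P_i[k])\Big)$$ subject to $(\ast)$, $\xi_i[k]\in\{0,1\}$ and $\sum_{i=1}^N\xi_i[k]=1$ for all $k$. Stochastic scheduling problem: for a probability vector $(q_1,\dots,q_N)$, at each time one system is selected at random, independently over time, system $i$ being selected with probability $q_i$; thus for each $i$ the $\xi_i[k]$, $k\ge1$, are i.i.d. Bernoulli with $\Pr(\xi_i[k]=1)=q_i$, and $\sum_i\xi_i[k]=1$. Then $$\mu_s=\min_{q_1,\dots,q_N}\ \max_i\ \mathrm{Tr}\Big(\lim_{k\to\infty}\mathbb{E}_{\xi_{i,k}}[P_i[k]]\Big)$$ subject to $(\ast)$, $\sum_{i=1}^Nq_i=1$, $0\le q_i\le 1$, where $\mathbb{E}_{\xi_{i,k}}$ denotes expectation with respect to $\xi_i[1],\dots,\xi_i[k]$. *)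

(* Defs.v *)
From HB Require Import structures.
From mathcomp Require Import all_boot all_order all_algebra.
From mathcomp Require Import all_classical all_reals all_analysis.
From mathcomp.real_closed Require Import complex.

Set Implicit Arguments.
Unset Strict Implicit.
Unset Printing Implicit Defensive.

Import Order.TTheory GRing.Theory Num.Theory.
Import numFieldNormedType.Exports.

Local Open Scope classical_set_scope.
Local Open Scope ring_scope.

Definition posdef (R : realType) (n : nat) (M : 'M[R]_n) : Prop :=
  M^T = M /\ forall x : 'cV[R]_n, x != 0 -> 0 < (x^T *m M *m x) ord0 ord0.

Definition possemidef (R : realType) (n : nat) (M : 'M[R]_n) : Prop :=
  M^T = M /\ forall x : 'cV[R]_n, 0 <= (x^T *m M *m x) ord0 ord0.

(* The positive semidefinite square root is unique, so this determines S. *)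
Definition is_sqrtmx (R : realType) (n : nat) (S M : 'M[R]_n) : Prop :=
  possemidef S /\ S *m S = M.

Fixpoint trajectory (R : realType) (n m : nat) (A : 'M[R]_n) (B : 'M[R]_(n, m))
    (x0 : 'cV[R]_n) (u : nat -> 'cV[R]_m) (k : nat) : 'cV[R]_n :=
  if k is j.+1 then A *m trajectory A B x0 u j + B *m u j else x0.

Definition controllable (R : realType) (n m : nat)
    (A : 'M[R]_n) (B : 'M[R]_(n, m)) : Prop :=
  forall x0 x1 : 'cV[R]_n, exists (T : nat) (u : nat -> 'cV[R]_m),
    trajectory A B x0 u T = x1.

(* The eigenvalues are the complex ones: M is viewed as a matrix over R[i]. *)
Definition schur_stable (R : realType) (n : nat) (M : 'M[R]_n) : Prop :=
  forall z : R[i],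
    eigenvalue (map_mx (fun x : R => x%:C%C) M) z -> `|z| < 1.

Definition detectable (R : realType) (n p : nat)
    (A : 'M[R]_n) (C : 'M[R]_(p, n)) : Prop :=
  exists L : 'M[R]_(n, p), schur_stable (A - L *m C).

Definition riccati (R : realType) (n p : nat) (A : 'M[R]_n)
    (C : 'M[R]_(p, n)) (Q : 'M[R]_n) (V : 'M[R]_p) (obs : bool)
    (P : 'M[R]_n) : 'M[R]_n :=
  A *m P *m A^T + Q
  - obs%:R *: (A *m P *m C^T *m invmx (C *m P *m C^T + V) *m C *m P *m A^T).

(* errcov A C Q V pi0 xi k is the one-step prediction covariance P[k] = P[k|k-1]
   for k >= 1; the value at 0 is the covariance of the initial state. *)
Fixpoint errcov (R : realType) (n p : nat) (A : 'M[R]_n)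
    (C : 'M[R]_(p, n)) (Q : 'M[R]_n) (V : 'M[R]_p) (pi0 : 'M[R]_n)
    (xi : nat -> bool) (k : nat) : 'M[R]_n :=
  match k with
  | 0 => pi0
  | j.+1 => match j with
            | 0 => A *m pi0 *m A^T + Q
            | _.+1 => riccati A C Q V (xi j) (errcov A C Q V pi0 xi j)
            end
  end.

Definition schedule (N : nat) (xi : 'I_N -> nat -> bool) : Prop :=
  forall k : nat, (0 < k)%N -> (\sum_(i < N) xi i k)%N = 1%N.

Definition average_cost (R : realType) (n p : nat) (A : 'M[R]_n)
    (C : 'M[R]_(p, n)) (Q : 'M[R]_n) (V : 'M[R]_p) (pi0 : 'M[R]_n)
    (xi : nat -> bool) : \bar R :=
  limn_esup (fun T : nat =>
    (T%:R^-1 * \sum_(1 <= k < T.+1) \tr (errcov A C Q V pi0 xi k))%:E).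

Definition mu_d (R : realType) (N : nat) (n p : 'I_N -> nat)
    (A : forall i, 'M[R]_(n i)) (C : forall i, 'M[R]_(p i, n i))
    (Q : forall i, 'M[R]_(n i)) (V : forall i, 'M[R]_(p i))
    (pi0 : forall i, 'M[R]_(n i)) : \bar R :=
  ereal_inf [set c | exists2 xi : 'I_N -> nat -> bool, schedule xi &
    c = \big[maxe/-oo%E]_(i < N)
          average_cost (A i) (C i) (Q i) (V i) (pi0 i) (xi i)].

(* Exactly one system is selected at each time k >= 1, system i with
   probability q i, and the selections at distinct times are mutually
   independent: since the events {xi_i[k] = 1}, for i < N, partition the sample
   space, the product rule below, over finite sets J of times and choices e of
   the system selected at each of them, is independence over k of the vectors
   (xi_i[k])_i. *)
Definition random_selection (R : realType) (N : nat) (q : 'I_N -> R)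
    (d : measure_display) (T : measurableType d) (P : probability T R)
    (xi : 'I_N -> nat -> {RV P >-> bool}) : Prop :=
  [/\ forall w : T, schedule (fun i k => xi i k w),
      forall (i : 'I_N) (k : nat), (0 < k)%N ->
        P [set w | xi i k w = true] = (q i)%:E
    & forall (J : seq nat) (e : nat -> 'I_N),
        uniq J -> (forall k, k \in J -> (0 < k)%N) ->
        P [set w | forall k, k \in J -> xi (e k) k w = true] =
        (\prod_(k <- J) P [set w | xi (e k) k w = true])%E].

Definition mean_errcov (R : realType) (n p : nat) (A : 'M[R]_n)
    (C : 'M[R]_(p, n)) (Q : 'M[R]_n) (V : 'M[R]_p) (pi0 : 'M[R]_n)
    (d : measure_display) (T : measurableType d) (P : probability T R)
    (xi : nat -> {RV P >-> bool}) (k : nat) : 'M[R]_n :=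
  \matrix_(a, b)
    fine ('E_P[fun w => errcov A C Q V pi0 (fun j => xi j w) k a b])%E.

(* The cost is +oo when the expected covariances have no finite limit. *)
Definition limit_cost (R : realType) (n p : nat) (A : 'M[R]_n)
    (C : 'M[R]_(p, n)) (Q : 'M[R]_n) (V : 'M[R]_p) (pi0 : 'M[R]_n)
    (d : measure_display) (T : measurableType d) (P : probability T R)
    (xi : nat -> {RV P >-> bool}) : \bar R :=
  if `[< cvgn (mean_errcov A C Q V pi0 xi) >]
  then (\tr (limn (mean_errcov A C Q V pi0 xi)))%:E else +oo%E.

(* The cost depends only on the law of the selection process, hence only on q,
   so ranging over all its realizations amounts to minimizing over q. *)
Definition mu_s (R : realType) (N : nat) (n p : 'I_N -> nat)
    (A : forall i, 'M[R]_(n i)) (C : forall i, 'M[R]_(p i, n i))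
    (Q : forall i, 'M[R]_(n i)) (V : forall i, 'M[R]_(p i))
    (pi0 : forall i, 'M[R]_(n i)) : \bar R :=
  ereal_inf [set c |
    exists (q : 'I_N -> R) (d : measure_display) (T : measurableType d)
           (P : probability T R) (xi : 'I_N -> nat -> {RV P >-> bool}),
      [/\ \sum_(i < N) q i = 1,
          forall i, 0 <= q i <= 1,
          random_selection q xi
        & c = \big[maxe/-oo%E]_(i < N)
                limit_cost (A i) (C i) (Q i) (V i) (pi0 i) (xi i)]].

(* Main.v *)
Require Import Defs.
From mathcomp Require Import all_boot all_order all_algebra.
From mathcomp Require Import all_classical all_reals all_analysis.
From mathcomp Require Import measurable_realfun.
From mathcomp Require Import ring lra.
Import Order.TTheory GRing.Theory Num.Theory.
Import numFieldNormedType.Exports.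
Local Open Scope ring_scope.

(** The idea.  Any random selection whose expected covariances converge yields,
    for every eps > 0, a deterministic schedule whose average costs exceed the
    limits by at most eps for all systems at once.  No law of large numbers is
    used: averages over random words are turned into averages over time by a
    choice of blocks.

    Fix the selection probabilities q, and call word a finite sequence of
    selected systems.  A word w acts on a covariance by composing Riccati maps
    ([run]), and the expected covariance at a given time is a finite weighted
    sum over words ([wmean], [tr_mean_errcov]).  Started at Q, its trace
    increases with time and stays below the limit c_i of system i
    ([mean_trace_cat], [mean_trace_le_limit]).

    Each Riccati map is a minimum over gains K of maps that are affine in the
    covariance P; hence it is monotone and satisfies
    ric (l P) <= l ric P - (l - 1) Q for l >= 1.  So if Y <= (1 + mu) X, the
    excess mu shrinks at each step by a factor 1 - 1/s, where s bounds the new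
    covariance relative to Q ([riccati_contract]).  Since s has a bounded mean,
    the product of these factors tends to 0 in mean
    ([mean_contraction_small]), and therefore the mean trace started from any
    multiple kappa Q is eventually at most c_i + eps ([mean_trace_run]).

    Now take kappa large, then a word length L large.  By Markov's inequality
    all words of length L but a set of small weight are good: for every system
    they map kappa_i Q_i below kappa_i Q_i.  Their weighted mean cost, started
    from kappa_i Q_i, is at most L (c_i + eps) ([good_blocks]).  Good words can
    be concatenated at will, because by monotonicity every block then starts
    below kappa_i Q_i ([block_start]).  It remains to order them so that the
    running averages of the costs of all systems tend to their weighted means;
    a greedy choice does this ([simultaneous_averaging]). *)

Set Implicit Arguments.
Unset Strict Implicit.
Unset Printing Implicit Defensive.

(** * Quadratic forms and the Loewner order *)

Section QuadraticForms.
Context {R : realType}.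

Definition qform n (M : 'M[R]_n) (x : 'cV[R]_n) : R := (x^T *m M *m x) ord0 ord0.

Definition loewner n (X Y : 'M[R]_n) : Prop := forall x, qform X x <= qform Y x.

Lemma qformD n (X Y : 'M[R]_n) x : qform (X + Y) x = qform X x + qform Y x.
Proof. by rewrite /qform mulmxDr mulmxDl mxE. Qed.

Lemma qformZ n a (X : 'M[R]_n) x : qform (a *: X) x = a * qform X x.
Proof. by rewrite /qform -scalemxAr -scalemxAl mxE. Qed.

Lemma qform_congr n m (B : 'M[R]_(n, m)) (M : 'M[R]_m) x :
  qform (B *m M *m B^T) x = qform M (B^T *m x).
Proof. by rewrite /qform trmx_mul trmxK !mulmxA. Qed.

Lemma qformE n (M : 'M[R]_n) x :
  qform M x = \sum_a \sum_b x a ord0 * M a b * x b ord0.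
Proof.
rewrite /qform mxE exchange_big /=; apply: eq_bigr => b _.
by rewrite mxE mulr_suml; apply: eq_bigr => a _; rewrite mxE.
Qed.

Lemma qform1 n (x : 'cV[R]_n) : qform 1%:M x = \sum_a x a ord0 ^+ 2.
Proof. by rewrite /qform mulmx1 mxE; apply: eq_bigr => a _; rewrite mxE expr2. Qed.

Lemma qform_delta n (M : 'M[R]_n) a b : 
  (delta_mx a ord0 : 'cV[R]_n)^T *m M *m (delta_mx b ord0 : 'cV[R]_n)
  = (M a b)%:M.
Proof.
apply/matrixP => u v; rewrite !ord1 trmx_delta -rowE -colE !mxE eqxx mulr1n //.
Qed.

Lemma qform_diag n (M : 'M[R]_n) a : qform M (delta_mx a ord0) = M a a.
Proof. by rewrite /qform qform_delta mxE eqxx mulr1n. Qed.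

Lemma loewner_refl n (X : 'M[R]_n) : loewner X X.
Proof. by move=> x. Qed.

Lemma loewner_trans n (Y X Z : 'M[R]_n) :
  loewner X Y -> loewner Y Z -> loewner X Z.
Proof. by move=> XY YZ x; apply: le_trans (XY x) (YZ x). Qed.

Lemma loewner_tr n (X Y : 'M[R]_n) : loewner X Y -> \tr X <= \tr Y.
Proof. by move=> XY; apply: ler_sum => a _; rewrite -!qform_diag. Qed.

Lemma psd_ge0 n (P : 'M[R]_n) x : possemidef P -> 0 <= qform P x.
Proof. by case=> _; apply. Qed.

Lemma psd_diag_ge0 n (P : 'M[R]_n) a : possemidef P -> 0 <= P a a.
Proof. by move=> /(psd_ge0 (delta_mx a ord0)); rewrite qform_diag. Qed.

Lemma psd_tr_ge0 n (P : 'M[R]_n) : possemidef P -> 0 <= \tr P.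
Proof. by move=> hP; apply: sumr_ge0 => a _; apply: psd_diag_ge0. Qed.

Lemma psd_scale n a (P : 'M[R]_n) : 0 <= a -> possemidef P -> possemidef (a *: P).
Proof.
move=> a0 hP; split; first by rewrite linearZ /= (proj1 hP).
by move=> x; change (0 <= qform (a *: P) x); rewrite qformZ mulr_ge0 // psd_ge0.
Qed.

Lemma posdef_psd n (P : 'M[R]_n) : posdef P -> possemidef P.
Proof.
move=> [Ps Pp]; split => // x; have [->|x0] := eqVneq x 0; last exact/ltW/Pp.
by rewrite mulmx0 mxE.
Qed.

(** Testing the form on the sum and the difference of two basis vectors bounds
    each off-diagonal entry by the diagonal ones. *)
Lemma psd_entry_bound n (P : 'M[R]_n) a b :
  possemidef P -> `|P a b| <= \tr P.
Proof.
move=> hP; have [Ps _] := hP.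
have Pab : P b a = P a b by rewrite -[in LHS]Ps mxE.
have e (s : R) : 
    qform P (delta_mx a ord0 + s *: delta_mx b ord0)
    = P a a + s ^+ 2 * P b b + 2 * s * P a b.
  rewrite /qform [(_ + _)^T]raddfD /= [(s *: _)^T]linearZ /=.
  rewrite !(mulmxDl, mulmxDr) -!(scalemxAl, scalemxAr).
  rewrite !qform_delta !mxE eqxx !mulr1n Pab; ring.
have h1 := psd_ge0 (delta_mx a ord0 + 1 *: delta_mx b ord0) hP.
have h2 := psd_ge0 (delta_mx a ord0 + (-1) *: delta_mx b ord0) hP.
rewrite !e in h1 h2.
have diag_le c : P c c <= \tr P.
  rewrite /mxtrace (bigD1 c) //= lerDl.
  by apply: sumr_ge0 => d _; apply: psd_diag_ge0.
have := diag_le a; have := diag_le b => ha hb.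
by rewrite ler_norml; apply/andP; split; lra.
Qed.

Lemma psd_le_tr n (P : 'M[R]_n) :
  possemidef P -> loewner P ((n%:R * \tr P) *: 1%:M).
Proof.
move=> hP x; rewrite qformZ qform1 qformE.
have t0 := psd_tr_ge0 hP.
apply: (@le_trans _ _ (\sum_a \sum_b
   (\tr P / 2 * x a ord0 ^+ 2 + \tr P / 2 * x b ord0 ^+ 2))).
  apply: ler_sum => a _; apply: ler_sum => b _.
  apply: (le_trans (ler_norm _)); rewrite !normrM.
  have hab := psd_entry_bound a b hP.
  rewrite -(real_normK (num_real (x a ord0))) -(real_normK (num_real (x b ord0))).
  set u := `|x a ord0|; set v := `|x b ord0|.
  have u0 : 0 <= u by apply: normr_ge0.
  have v0 : 0 <= v by apply: normr_ge0.
  apply: (@le_trans _ _ (\tr P * (u * v))).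
    by rewrite mulrAC [_ * v * _]mulrC ler_wpM2r // mulr_ge0.
  have := mulr_ge0 t0 (sqr_ge0 (u - v)); set t := \tr P; nra.
set s := \sum_a x a ord0 ^+ 2.
rewrite (eq_bigr (fun a => n%:R * (\tr P / 2 * x a ord0 ^+ 2) + \tr P / 2 * s)).
  rewrite big_split /= -!mulr_sumr sumr_const card_ord -mulr_natl -/s.
  by rewrite le_eqVlt; apply/orP; left; apply/eqP; field.
by move=> a _; rewrite big_split /= sumr_const card_ord -mulr_sumr mulr_natl.
Qed.

Lemma psd_gram n m (B : 'M[R]_(m, n)) : possemidef (B^T *m B).
Proof.
split; first by rewrite trmx_mul trmxK.
move=> x; rewrite mulmxA -trmx_mul -mulmxA mxE.
by apply: sumr_ge0 => a _; rewrite mxE -expr2 sqr_ge0.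
Qed.

Lemma qform_eq0_unit n (M : 'M[R]_n) :
  (forall x : 'cV[R]_n, x != 0 -> 0 < qform M x) -> M \in unitmx.
Proof.
move=> hM; rewrite -unitmx_tr -row_free_unit -kermx_eq0.
apply/eqP/row_matrixP => i; rewrite row0; apply/eqP/negPn/negP => ki.
have := hM (row i (kermx M^T))^T; rewrite trmx_eq0 => /(_ ki).
rewrite /qform -mulmxA.
have -> : M *m (row i (kermx M^T))^T = 0.
  by apply: trmx_inj; rewrite trmx_mul trmxK trmx0 -row_mul mulmx_ker row0.
by rewrite mulmx0 mxE ltxx.
Qed.

(** A positive definite matrix dominates every positive semidefinite one up to
    the trace of the latter.  The square root gives the constant without any
    compactness: x is the inverse of S applied to S x, and the squared norm of
    S x is the value of the form Q at x. *)
Lemma posdef_dominates n (S Q : 'M[R]_n) :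
  posdef Q -> is_sqrtmx S Q ->
  exists2 beta : R, 0 <= beta &
    forall P, possemidef P -> loewner P ((beta * \tr P) *: Q).
Proof.
move=> [Qs Qp] [[Ss _] SSQ].
have Su : S \in unitmx.
  have : Q \in unitmx by apply: qform_eq0_unit.
  by rewrite -SSQ unitmx_mul andbb.
pose B := invmx S.
have t0 := psd_tr_ge0 (psd_gram B).
exists (n%:R * (n%:R * \tr (B^T *m B))); first by rewrite !mulr_ge0.
move=> P hP x; apply: (le_trans (psd_le_tr hP x)).
rewrite !qformZ.
have hx : qform 1%:M x = qform (B^T *m B) (S *m x).
  have BS : B *m (S *m x) = x by rewrite mulKmx.
  by rewrite /qform mulmx1 (mulmxA _ B^T) -trmx_mul BS -mulmxA BS.
have hQ : qform Q x = qform 1%:M (S *m x).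
  by rewrite /qform mulmx1 trmx_mul Ss -SSQ !mulmxA.
have := psd_le_tr (psd_gram B) (S *m x).
rewrite -hx qformZ -hQ => h.
apply: le_trans (ler_wpM2l _ h) _; first by rewrite mulr_ge0 ?psd_tr_ge0.
by rewrite le_eqVlt; apply/orP; left; apply/eqP; ring.
Qed.

End QuadraticForms.

(** * The Riccati map *)

Section Riccati.
Context {R : realType}.
Variables (n p : nat) (A : 'M[R]_n) (C : 'M[R]_(p, n)) (Q : 'M[R]_n) (V : 'M[R]_p).
Hypotheses (Q_psd : possemidef Q) (V_posdef : posdef V).

Local Notation ric := (riccati A C Q V).

(** The prediction error covariance of the linear observer with gain K, in
    Joseph form: unlike the Riccati map, it is affine in P. *)
Definition joseph (K : 'M[R]_(n, p)) (P : 'M[R]_n) : 'M[R]_n :=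
  (A - K *m C) *m P *m (A - K *m C)^T + K *m V *m K^T + Q.

Let innov (P : 'M[R]_n) := C *m P *m C^T + V.

Definition kalman_gain (P : 'M[R]_n) : 'M[R]_(n, p) :=
  A *m P *m C^T *m invmx (innov P).

Lemma innov_posdef P : possemidef P -> posdef (innov P).
Proof.
move=> hP; split.
  by rewrite /innov linearD /= !trmx_mul trmxK (proj1 hP) (proj1 V_posdef) mulmxA.
move=> x x0; change (0 < qform (innov P) x).
rewrite qformD qform_congr ltr_wpDl ?psd_ge0 //.
exact: (proj2 V_posdef).
Qed.

(** Completing the square in the gain: the Kalman gain is the minimizer, and
    the case b = false is that of the zero gain. *)
Lemma joseph_riccati K P (b : bool) : possemidef P ->
  joseph (b%:R *: K) P = ric b P
    + b%:R *: ((K - kalman_gain P) *m innov P *m (K - kalman_gain P)^T).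
Proof.
move=> hP; have [Ss Sp] := innov_posdef hP.
have Su := qform_eq0_unit Sp; have Ps := proj1 hP.
case: b; rewrite /joseph /riccati ?scale0r ?scale1r; last first.
  by rewrite !mul0mx !subr0 !addr0.
set S := innov P in Ss Su *; set G := A *m P *m C^T.
have KS : kalman_gain P *m S = G by rewrite /kalman_gain -mulmxA mulVmx // mulmx1.
have SK : S *m (kalman_gain P)^T = G^T.
  by rewrite -[S in LHS]Ss -trmx_mul KS.
have GT : G^T = C *m P *m A^T by rewrite !trmx_mul trmxK Ps mulmxA.
have KSK : kalman_gain P *m G^T = G *m invmx S *m C *m P *m A^T.
  by rewrite GT !mulmxA.
have -> : (K - kalman_gain P) *m S *m (K - kalman_gain P)^T =
   K *m S *m K^T - K *m G^T - G *m K^T + kalman_gain P *m G^T.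
  rewrite [(K - _)^T]raddfB /= mulmxBl KS mulmxBr !mulmxBl.
  rewrite -[K *m S *m (kalman_gain P)^T]mulmxA SK.
  have -> : G *m (kalman_gain P)^T = kalman_gain P *m G^T by rewrite -SK mulmxA KS.
  by apply/matrixP => i j; rewrite !mxE; ring.
rewrite KSK.
have -> : (A - K *m C) *m P *m (A - K *m C)^T =
   A *m P *m A^T - G *m K^T - K *m G^T + K *m (C *m P *m C^T) *m K^T.
  rewrite [(A - _)^T]raddfB /= trmx_mul GT !(mulmxBl, mulmxBr) !mulmxA.
  by apply/matrixP => i j; rewrite !mxE; ring.
have -> : K *m S *m K^T = K *m (C *m P *m C^T) *m K^T + K *m V *m K^T.
  by rewrite -mulmxDl -mulmxDr.
set a := A *m P *m A^T; set gk := G *m K^T; set kg := K *m G^T.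
set z := G *m _ *m C *m P *m A^T; set kc := K *m _ *m K^T; set kv := K *m V *m K^T.
rewrite -/G -/z.
apply/matrixP => i j; rewrite !mxE; ring.
Qed.

Lemma riccati_le_joseph K P (b : bool) : possemidef P ->
  loewner (ric b P) (joseph (b%:R *: K) P).
Proof.
move=> hP x; rewrite joseph_riccati // qformD qformZ lerDl.
rewrite mulr_ge0 ?ler0n // qform_congr psd_ge0 //.
exact/posdef_psd/innov_posdef.
Qed.

Lemma riccati_kalman P (b : bool) : possemidef P ->
  ric b P = joseph (b%:R *: kalman_gain P) P.
Proof. by move=> hP; rewrite joseph_riccati // subrr !mul0mx scaler0 addr0. Qed.

Lemma qform_joseph K P x : qform (joseph K P) x =
  qform P ((A - K *m C)^T *m x) + qform V (K^T *m x) + qform Q x.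
Proof. by rewrite /joseph !qformD !qform_congr. Qed.

Let V_psd : possemidef V := posdef_psd V_posdef.

Lemma riccati_geQ P (b : bool) : possemidef P -> loewner Q (ric b P).
Proof.
move=> hP x; rewrite riccati_kalman // qform_joseph.
by rewrite lerDr addr_ge0 ?psd_ge0.
Qed.

Lemma riccati_psd P (b : bool) : possemidef P -> possemidef (ric b P).
Proof.
move=> hP; split; last first.
  move=> x; exact: le_trans (psd_ge0 x Q_psd) (riccati_geQ b hP x).
rewrite riccati_kalman // /joseph; set K := b%:R *: _; set F := A - _.
rewrite [(_ + Q)^T]raddfD /= [(_ + _ *m V *m _)^T]raddfD /= !trmx_mul !trmxK.
by rewrite (proj1 hP) (proj1 Q_psd) (proj1 V_posdef) !mulmxA.
Qed.

Lemma riccati_mono X Y (b : bool) : possemidef X -> possemidef Y ->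
  loewner X Y -> loewner (ric b X) (ric b Y).
Proof.
move=> hX hY XY x; apply: (le_trans (riccati_le_joseph (kalman_gain Y) b hX x)).
by rewrite (riccati_kalman b hY) !qform_joseph !lerD2r.
Qed.

(** The optimal gain for P, used at l *: P, scales only the part of the
    covariance that comes from P: the noise Q is not multiplied by l. *)
Lemma riccati_scale P (b : bool) l x : possemidef P -> 1 <= l ->
  qform (ric b (l *: P)) x <= l * qform (ric b P) x - (l - 1) * qform Q x.
Proof.
move=> hP l1; have l0 : 0 <= l by apply: le_trans l1.
apply: (le_trans (riccati_le_joseph (kalman_gain P) b (psd_scale l0 hP) x)).
rewrite (riccati_kalman b hP) !qform_joseph qformZ.
set K := b%:R *: _; have := psd_ge0 (K^T *m x) V_psd; nra.
Qed.

(** The part Q of the new covariance is not multiplied by 1 + mu, and it is at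
    least the fraction 1/s of the whole; this is what shrinks mu. *)
Lemma riccati_contract X Y (b : bool) mu s : possemidef X -> possemidef Y ->
  0 <= mu -> 1 <= s -> loewner Y ((1 + mu) *: X) ->
  loewner (ric b X) (s *: Q) ->
  loewner (ric b Y) ((1 + mu * (1 - s^-1)) *: ric b X).
Proof.
move=> hX hY mu0 s1 YX XQ x.
have l1 : 1 <= 1 + mu by rewrite lerDl.
have l0 : 0 <= 1 + mu by apply: le_trans l1.
have s0 : 0 < s by apply: lt_le_trans s1.
apply: (le_trans (riccati_mono b hY (psd_scale l0 hX) YX x)).
apply: (le_trans (riccati_scale b x hX l1)); rewrite qformZ.
have := XQ x; rewrite qformZ -ler_pdivrMl // => h.
have := ler_wpM2l mu0 h; set q := qform Q x; set r := qform _ x.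
rewrite (_ : 1 + mu - 1 = mu); [lra | ring].
Qed.

End Riccati.

(** * Averages over words of independent letters *)

Section Words.
Context {R : realType} {I : finType}.

Fixpoint words (k : nat) : seq (seq I) :=
  if k is k'.+1 then [seq j :: w | j <- enum I, w <- words k'] else [:: [::]].

Lemma mem_words k (w : seq I) : (w \in words k) = (size w == k).
Proof.
elim: k w => [|k IH] [|j w] //=.
  by apply/negbTE/negP => /allpairsP[[? ?] [_ _ //]].
rewrite eqSS -IH; apply/allpairsP/idP => [[[j' w'] /= [_ hw [_ ->]]] //|hw].
by exists (j, w); split => //=; rewrite mem_enum.
Qed.

Lemma uniq_words k : uniq (words k).
Proof.
elim: k => //= k IH; apply: allpairs_uniq; rewrite ?enum_uniq //.
by move=> [? ?] [? ?] _ _ [-> ->].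
Qed.

Variable q : I -> R.

Definition wmean (k : nat) (g : seq I -> R) : R :=
  \sum_(w <- words k) (\prod_(j <- w) q j) * g w.

Lemma wmean0 g : wmean 0 g = g [::].
Proof. by rewrite /wmean big_seq1 big_nil mul1r. Qed.

Lemma wmeanS k g : wmean k.+1 g = \sum_j q j * wmean k (fun w => g (j :: w)).
Proof.
rewrite /wmean /= big_allpairs_dep big_enum /=; apply: eq_bigr => j _.
by rewrite mulr_sumr; apply: eq_bigr => w _; rewrite big_cons mulrA.
Qed.

Lemma eq_wmean k g h :
  (forall w, size w = k -> g w = h w) -> wmean k g = wmean k h.
Proof.
move=> gh; rewrite /wmean big_seq [RHS]big_seq; apply: eq_bigr => w.
by rewrite mem_words => /eqP/gh ->.
Qed.

Lemma wmean_cat k m g :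
  wmean (k + m) g = wmean k (fun u => wmean m (fun v => g (u ++ v))).
Proof.
elim: k g => [|k IH] g; first by rewrite add0n wmean0.
by rewrite addSn !wmeanS; apply: eq_bigr => j _; rewrite IH.
Qed.

Lemma wmeanD k g h : wmean k (fun w => g w + h w) = wmean k g + wmean k h.
Proof. by rewrite /wmean -big_split; apply: eq_bigr => w _; rewrite mulrDr. Qed.

Lemma wmeanZ k a g : wmean k (fun w => a * g w) = a * wmean k g.
Proof. by rewrite /wmean mulr_sumr; apply: eq_bigr => w _; rewrite mulrCA. Qed.

Lemma wmeanB k g h : wmean k (fun w => g w - h w) = wmean k g - wmean k h.
Proof.
rewrite -mulN1r -wmeanZ -wmeanD; apply: eq_wmean => w _; by rewrite mulN1r.
Qed.

Lemma wmean_sum (J : Type) (r : seq J) k (g : J -> seq I -> R) :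
  wmean k (fun w => \sum_(i <- r) g i w) = \sum_(i <- r) wmean k (g i).
Proof.
by rewrite /wmean exchange_big /=; apply: eq_bigr => w _; rewrite mulr_sumr.
Qed.

Hypotheses (q_ge0 : forall j, 0 <= q j) (q_sum1 : \sum_j q j = 1).

Lemma wmean_le k g h :
  (forall w, size w = k -> g w <= h w) -> wmean k g <= wmean k h.
Proof.
move=> gh; rewrite /wmean big_seq [leRHS]big_seq; apply: ler_sum => w.
by rewrite mem_words => /eqP/gh ghw; rewrite ler_wpM2l // prodr_ge0.
Qed.

Lemma wmean_const k c : wmean k (fun=> c) = c.
Proof.
elim: k => [|k IH]; first by rewrite wmean0.
by rewrite wmeanS IH -mulr_suml q_sum1 mul1r.
Qed.

Lemma wmean_take l k g : (l <= k)%N ->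
  wmean k (fun w => g (take l w)) = wmean l g.
Proof.
move=> lk; rewrite -{1}(subnKC lk) wmean_cat; apply: eq_wmean => u hu.
rewrite -[RHS](wmean_const (k - l)); apply: eq_wmean => v _.
by rewrite take_size_cat.
Qed.

End Words.

(** * Forgetting the initial covariance *)

Section Forgetting.
Context {R : realType} {I : finType}.
Variables (n p : nat) (A : 'M[R]_n) (C : 'M[R]_(p, n)) (Q : 'M[R]_n) (V : 'M[R]_p).
Variable obs : I -> bool.
Hypotheses (Q_psd : possemidef Q) (V_posdef : posdef V).

Definition run (P : 'M[R]_n) (w : seq I) : 'M[R]_n :=
  foldl (fun P j => riccati A C Q V (obs j) P) P w.

Lemma run_cat P u v : run P (u ++ v) = run (run P u) v.
Proof. by rewrite /run foldl_cat. Qed.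

Lemma run_rcons P u j : run P (rcons u j) = riccati A C Q V (obs j) (run P u).
Proof. by rewrite /run foldl_rcons. Qed.

Lemma run_psd P w : possemidef P -> possemidef (run P w).
Proof. by elim: w P => //= j w IH P hP; apply: IH; apply: riccati_psd. Qed.

Lemma run_mono X Y w : possemidef X -> possemidef Y ->
  loewner X Y -> loewner (run X w) (run Y w).
Proof.
elim: w X Y => //= j w IH X Y hX hY XY.
by apply: IH; [exact: riccati_psd..|exact: riccati_mono].
Qed.

Lemma run_geQ P w : possemidef P -> loewner Q P -> loewner Q (run P w).
Proof. by elim: w P => //= j w IH P hP QP; apply: IH; [exact: riccati_psd|exact: riccati_geQ]. Qed.

Lemma run_scale P w l : possemidef P -> 1 <= l ->
  loewner (run (l *: P) w) (l *: run P w).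
Proof.
move=> hP l1; have l0 : 0 <= l by apply: le_trans l1.
elim/last_ind: w => [|w j IH]; first exact: loewner_refl.
rewrite !run_rcons => x; have hw := run_psd w hP.
have hlw : possemidef (run (l *: P) w) by apply/run_psd/psd_scale.
have h := riccati_mono A C Q V_posdef (obs j) hlw (psd_scale l0 hw) IH x.
apply: (le_trans h).
apply: (le_trans (riccati_scale A C Q V_posdef (obs j) x hw l1)).
by rewrite qformZ gerBl mulr_ge0 ?psd_ge0 // subr_ge0.
Qed.

Lemma tr_run_ge0 P w : possemidef P -> 0 <= \tr (run P w).
Proof. by move=> hP; apply/psd_tr_ge0/run_psd. Qed.

Variable beta : R.
Hypothesis beta_ge0 : 0 <= beta.
Hypothesis dominates : forall P, possemidef P -> loewner P ((beta * \tr P) *: Q).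

(** An upper bound, at least 1, for the covariance reached from Q relative to
    Q; it is affine in the trace, so its mean is controlled. *)
Definition rel_size (w : seq I) : R := 1 + beta * \tr (run Q w).

(** The factor by which a word shrinks the relative excess of any covariance
    over the one started at Q. *)
Definition contraction (w : seq I) : R :=
  \prod_(1 <= l < (size w).+1) (1 - (rel_size (take l w))^-1).

Lemma rel_size_ge1 w : 1 <= rel_size w.
Proof. by rewrite lerDl mulr_ge0 // tr_run_ge0. Qed.

Lemma rel_size_inv w : 0 <= (rel_size w)^-1 <= 1.
Proof.
have h := rel_size_ge1 w; have h0 : 0 < rel_size w by apply: lt_le_trans h.
by rewrite invr_ge0 ltW //= invf_le1.
Qed.

Lemma contraction_rcons w j :
  contraction (rcons w j) = contraction w * (1 - (rel_size (rcons w j))^-1).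
Proof.
rewrite /contraction size_rcons big_nat_recr //= [take (size w).+1 _]take_oversize ?size_rcons //.
congr (_ * _); apply: eq_big_nat => l /andP[_ lw].
by rewrite -cats1 takel_cat.
Qed.

Lemma contraction_01 w : 0 <= contraction w <= 1.
Proof.
elim/last_ind: w => [|w j /andP[IH0 IH1]].
  by rewrite /contraction big_geq // ler01 lexx.
rewrite contraction_rcons; have /andP[h0 h1] := rel_size_inv (rcons w j).
by rewrite mulr_ge0 ?subr_ge0 //= mulr_ile1 ?subr_ge0 // gerBl.
Qed.

Lemma run_contraction kappa w : 1 <= kappa ->
  loewner (run (kappa *: Q) w) ((1 + (kappa - 1) * contraction w) *: run Q w).
Proof.
move=> k1; have k0 : 0 <= kappa by apply: le_trans k1.
elim/last_ind: w => [|w j IH].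
  by rewrite /contraction big_geq //= mulr1 addrCA subrr addr0; apply: loewner_refl.
rewrite !run_rcons contraction_rcons mulrA.
have /andP[c0 _] := contraction_01 w.
apply: riccati_contract => //.
- exact: run_psd.
- exact/run_psd/psd_scale.
- by rewrite mulr_ge0 ?subr_ge0.
- exact: rel_size_ge1.
- rewrite -run_rcons => x; apply: (le_trans (dominates (run_psd _ Q_psd) x)).
  by rewrite !qformZ /rel_size mulrDl mul1r lerDr psd_ge0.
Qed.

Variable q : I -> R.
Hypotheses (q_ge0 : forall j, 0 <= q j) (q_sum1 : \sum_j q j = 1).

Local Notation E k g := (wmean q k g).

Variable c : R.
Hypothesis mean_le : forall k, E k (fun w => \tr (run Q w)) <= c.

Let e k := E k (fun w => \tr (run Q w)).
Let r k := E k contraction.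

Lemma mean_bound_ge0 : 0 <= c.
Proof. by apply: le_trans (mean_le 0); rewrite wmean0 psd_tr_ge0. Qed.

Lemma mean_contraction_ge0 k : 0 <= r k.
Proof.
rewrite -[leLHS](wmean_const q_sum1 k); apply: wmean_le => // w _.
by have /andP[] := contraction_01 w.
Qed.

(** The tangent line of the inverse function, at the point 1/x, linearizes the
    factor 1 - 1/s, so that only the mean of s is needed. *)
Lemma mean_contraction_step k x : 0 <= x ->
  r k.+1 + (2 * x * r k.+1 - x ^+ 2 * (1 + beta * c)) <= r k.
Proof.
move=> x0.
have -> : r k = E k.+1 (fun w => contraction (take k w)) by rewrite wmean_take.
apply: (@le_trans _ _ (E k.+1 (fun w => contraction w +
   (2 * x * contraction w - x ^+ 2 * rel_size w)))).
  rewrite wmeanD wmeanB !wmeanZ lerD2l lerB // ler_wpM2l ?sqr_ge0 //.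
  by rewrite wmeanD wmeanZ wmean_const // lerD2l ler_wpM2l.
apply: wmean_le => // w; case/lastP: w => // w j.
rewrite size_rcons => -[wk].
rewrite -cats1 take_size_cat // cats1.
have s1 := rel_size_ge1 (rcons w j).
have /andP[c0 c1] := contraction_01 (rcons w j).
have /andP[d0 d1] := contraction_01 w.
have hc := contraction_rcons w j.
set s := rel_size _ in s1 hc *; set y := contraction (rcons w j) in c0 c1 hc *.
set z := contraction w in hc d0 d1 *.
have s0 : 0 < s by apply: lt_le_trans s1.
have zy : z - y = z * s^-1 by rewrite hc; ring.
have si0 : 0 <= s^-1 by rewrite invr_ge0 ltW.
have yz : y <= z by rewrite -subr_ge0 zy mulr_ge0.
have tangent : 2 * x - x ^+ 2 * s <= s^-1.
  have := mulr_ge0 si0 (sqr_ge0 (1 - x * s)).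
  rewrite (_ : s^-1 * _ = s^-1 - 2 * x + x ^+ 2 * s); last by field; rewrite gt_eqF.
  lra.
have h1 : y * s^-1 <= z - y by rewrite zy ler_wpM2r.
have h2 := ler_wpM2l c0 tangent.
have h3 : 0 <= (1 - y) * (x ^+ 2 * s).
  by rewrite mulr_ge0 ?subr_ge0 // mulr_ge0 ?sqr_ge0 // ltW.
nra.
Qed.

Lemma mean_contraction_nonincr k l : (k <= l)%N -> r l <= r k.
Proof.
move=> kl; rewrite -(subnKC kl); elim: (l - k)%N => [|d IH]; first by rewrite addn0.
rewrite addnS; apply: le_trans IH.
by have := mean_contraction_step (k + d) (lexx 0); rewrite mulr0 mul0r expr0n mul0r subr0 addr0.
Qed.

(** If the means stayed above eps, each step would decrease them by a fixed
    amount, and they would become negative. *)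
Lemma mean_contraction_small eps : 0 < eps -> exists k, r k <= eps.
Proof.
move=> eps0; apply: contrapT => /forallNP hr.
have {}hr k : eps <= r k by rewrite ltW // ltNge; apply/negP/hr.
have c0 := mean_bound_ge0.
pose c' := 1 + beta * c.
have c'0 : 0 < c' by rewrite ltr_wpDr ?ltr01 // mulr_ge0.
(* x = eps / c' maximizes 2 x eps - x^2 c', the guaranteed decrease; the
   maximal value is d. *)
pose d := eps ^+ 2 / c'.
have d0 : 0 < d by rewrite divr_gt0 ?exprn_gt0.
have step k : r k.+1 + d <= r k.
  have x0 : 0 <= eps / c' by rewrite divr_ge0 ?ltW.
  apply: le_trans (mean_contraction_step k x0); rewrite lerD2l.
  have := ler_wpM2l x0 (hr k.+1).
  rewrite -/c' (_ : (eps / c') ^+ 2 * c' = d); last by rewrite /d; field; rewrite gt_eqF.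
  rewrite (_ : eps / c' * eps = d); last by rewrite /d; field; rewrite gt_eqF.
  lra.
have lin k : r k + k%:R * d <= 1.
  elim: k => [|k IH].
    by rewrite mul0r addr0 /r wmean0 /contraction big_geq.
  by have := step k; rewrite -natr1 mulrDl mul1r; lra.
have := archi_boundP (ltW (divr_gt0 ltr01 d0)).
rewrite ltr_pdivrMr // => h.
by have := lin (Num.bound (1 / d)); have := mean_contraction_ge0 (Num.bound (1/d)); lra.
Qed.

(** The first k letters bring Q to a covariance that is still at least Q, and
    the last m letters have the law of a word of length m. *)
Lemma mean_trace_cat k m : e m <= e (k + m)%N.
Proof.
rewrite /e wmean_cat -[leLHS](wmean_const q_sum1 k).
apply: wmean_le => // u _; apply: wmean_le => // v _; rewrite run_cat.
apply/loewner_tr/run_mono => //; first exact: run_psd.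
exact/run_geQ/loewner_refl.
Qed.

Lemma mean_trace_cauchy eps : 0 < eps -> exists m, forall k, e (k + m)%N - e m <= eps.
Proof.
move=> eps0; pose S := range e.
have S0 : has_sup S by split; [exists (e 0); exists 0%N | exists c => _ [k _ <-]; exact: mean_le].
have [_ [m _ <-] hm] := sup_adherent eps0 S0.
exists m => k; have : e (k + m)%N <= sup S.
  by apply: sup_ubound; [case: S0|exists (k + m)%N].
lra.
Qed.

(** On a word u v, the covariance started at kappa Q exceeds the one started
    at Q by at most the multiple (kappa - 1) * contraction u of the latter.
    Replacing that multiplied trace by the trace of v alone makes the two
    factors independent; this costs at most the difference of the mean traces
    at the lengths of u v and of v, which is small once v is long. *)
Lemma mean_trace_run kappa eps : 1 <= kappa -> 0 < eps ->
  exists l0, forall l, (l0 <= l)%N ->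
    E l (fun w => \tr (run (kappa *: Q) w)) <= c + eps.
Proof.
move=> k1 eps0; have c0 := mean_bound_ge0.
have k0 : 0 <= kappa by apply: le_trans k1.
have kap0 : 0 <= kappa - 1 by rewrite subr_ge0.
pose den := (kappa - 1) * (c + 1) + 1.
have den0 : 0 < den by rewrite ltr_wpDl // mulr_ge0 // addr_ge0.
pose e1 := eps / den; have e10 : 0 < e1 by rewrite divr_gt0.
have [k hk] := mean_contraction_small e10.
have [m hm] := mean_trace_cauchy e10.
exists (k + m)%N => l kml.
have hl : l = ((l - m) + m)%N by rewrite subnK //; apply: leq_trans kml; apply: leq_addl.
have hkl : (k <= l - m)%N by rewrite -(leq_add2r m) -hl.
rewrite hl; set k' := (l - m)%N in hkl *.
have rk : r k' <= e1 by apply: le_trans hk; apply: mean_contraction_nonincr.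
apply: (@le_trans _ _ (e (k' + m)%N + (kappa - 1) * (r k' * e m + (e (k' + m)%N - e m)))).
  pose tail := fun u v => \tr (run Q (u ++ v)).
  have ek : e (k' + m)%N = E k' (fun u => E m (tail u)) by rewrite /e wmean_cat.
  have em : e m = E k' (fun=> e m) by rewrite wmean_const.
  apply: (@le_trans _ _ (E k' (fun u => E m (tail u) +
     (kappa - 1) * (e m * contraction u + (E m (tail u) - e m))))); last first.
    by rewrite wmeanD wmeanZ wmeanD wmeanB wmeanZ -ek -em [e m * _]mulrC.
  rewrite wmean_cat; apply: wmean_le => // u _.
  rewrite [e m * _]mulrC /e -wmeanB -wmeanZ -wmeanD -wmeanZ -wmeanD.
  apply: wmean_le => // v _.
  have /andP[ct0 ct1] := contraction_01 u.
  have l1 : 1 <= 1 + (kappa - 1) * contraction u by rewrite lerDl mulr_ge0.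
  have hQk : possemidef (kappa *: Q) by apply: psd_scale.
  have hQu := run_psd u Q_psd.
  apply: (@le_trans _ _ ((1 + (kappa - 1) * contraction u) * tail u v)).
    rewrite -mxtraceZ /tail !run_cat.
    apply/loewner_tr/(@loewner_trans _ _ (run ((1 + (kappa - 1) * contraction u) *: run Q u) v)).
      apply: run_mono; [exact: run_psd| |exact: run_contraction].
      by apply: psd_scale => //; apply: le_trans l1.
    exact: run_scale.
  rewrite mulrDl mul1r lerD2l -mulrA ler_wpM2l //.
  have : \tr (run Q v) <= tail u v.
    rewrite /tail run_cat; apply/loewner_tr/run_mono => //.
    exact/run_geQ/loewner_refl.
  nra.
have em0 : 0 <= e m.
  rewrite -[leLHS](wmean_const q_sum1 m); apply: wmean_le => // w _; exact: tr_run_ge0.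
apply: lerD; first exact: mean_le.
apply: (@le_trans _ _ ((kappa - 1) * (e1 * c + e1))).
  rewrite ler_wpM2l // lerD // ler_pM //; first exact: mean_contraction_ge0.
  exact: mean_le.
have -> : eps = den * e1 by rewrite /e1; field; rewrite gt_eqF.
by rewrite /den; nra.
Qed.

End Forgetting.

(** * Realizing several averages by one sequence *)

(** Given finitely many items with weights, some sequence of items makes the
    running sums of all the quantities a i track their weighted means at once.
    For any vector s, the weighted mean of the inner product of s with the
    deviation vector vanishes, so some item makes that product nonpositive;
    choosing it when s is the current vector of cumulated deviations, the
    squared norm of s grows by at most a constant D at each step. *)
Lemma simultaneous_averaging (R : realType) (I : finType) (T : eqType)
    (G : seq T) (pr : T -> R) (a : I -> T -> R) :
    {in G, forall w, 0 <= pr w} -> 0 < \sum_(w <- G) pr w ->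
  exists (f : nat -> T) (D : R),
    [/\ 0 <= D, forall b, f b \in G &
     forall i b, (\sum_(0 <= t < b) (a i (f t) -
        (\sum_(w <- G) pr w * a i w) / \sum_(w <- G) pr w)) ^+ 2 <= b%:R * D].
Proof.
move=> pr0; set W := \sum_(w <- G) pr w => W0.
pose m i := (\sum_(w <- G) pr w * a i w) / W.
pose d i w := a i w - m i.
have mean0 i : \sum_(w <- G) pr w * d i w = 0.
  rewrite (eq_bigr (fun w => pr w * a i w - pr w * m i)) => [|w _]; last by rewrite mulrBr.
  rewrite sumrB -mulr_suml -/W /m mulrCA mulfV ?gt_eqF // mulr1 subrr //.
have /choice[pick pickP] (s : I -> R) :
    exists w, w \in G /\ \sum_i s i * d i w <= 0.
  apply: contrapT => /forallNP h.
  have pos w : w \in G -> 0 < \sum_i s i * d i w.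
    by move=> wG; rewrite ltNge; apply/negP => hw; apply: (h w).
  have : \sum_(w <- G | w \in G) pr w * \sum_i s i * d i w == 0.
    rewrite -big_seq (eq_bigr (fun w => \sum_i s i * (pr w * d i w))) => [|w _].
      rewrite exchange_big /= big1 // => i _.
      by rewrite -mulr_sumr mean0 mulr0.
    by rewrite mulr_sumr; apply: eq_bigr => i _; rewrite mulrCA.
  rewrite psumr_eq0 => [/allP h0|w wG]; last by rewrite mulr_ge0 ?pr0 // ltW ?pos.
  move: W0; rewrite /W big_seq big1 ?ltxx // => w wG.
  have := h0 w wG; rewrite wG /= mulf_eq0 => /orP[/eqP //|].
  by rewrite gt_eqF // pos.
pose st := fix st b := if b is b'.+1
  then fun i : I => st b' i + d i (pick (st b')) else fun=> 0.
pose D := \sum_(w <- G) \sum_i d i w ^+ 2.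
have D0 : 0 <= D by do 2 (apply: sumr_ge0 => ? _); apply: sqr_ge0.
have dD w : w \in G -> \sum_i d i w ^+ 2 <= D.
  move=> wG; rewrite /D (big_rem w) //= lerDl.
  by do 2 (apply: sumr_ge0 => ? _); apply: sqr_ge0.
have normD b : \sum_i st b i ^+ 2 <= b%:R * D.
  elim: b => [|b IH]; first by rewrite mul0r big1 // => i _; rewrite expr0n.
  have [hG hs] := pickP (st b); have hD := dD _ hG.
  rewrite (eq_bigr (fun i => st b i ^+ 2 + st b i * d i (pick (st b)) *+ 2
     + d i (pick (st b)) ^+ 2)) => [|i _]; last by rewrite /= sqrrD.
  rewrite !big_split /= -natr1 mulrDl mul1r.
  lra.
exists (fun b => pick (st b)), D; split => // [b|i b]; first by have [] := pickP (st b).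
have -> : \sum_(0 <= t < b) (a i (pick (st t)) - m i) = st b i.
  elim: b => [|b IH]; first by rewrite big_geq.
  by rewrite big_nat_recr //= IH.
apply: le_trans (normD b); rewrite (bigD1 i) //= lerDl.
by apply: sumr_ge0 => j _; apply: sqr_ge0.
Qed.

(** * Concatenating blocks of a fixed length *)

Section Blocks.
Context {R : realType} {I : finType}.
Variables (n p : nat) (A : 'M[R]_n) (C : 'M[R]_(p, n)) (Q : 'M[R]_n) (V : 'M[R]_p).
Variable obs : I -> bool.
Hypotheses (Q_psd : possemidef Q) (V_posdef : posdef V).
Variables (j0 : I) (f : nat -> seq I) (L : nat).
Hypotheses (L_gt0 : (0 < L)%N) (size_f : forall b, size (f b) = L).

Definition concat (l : nat) : I := nth j0 (f (l %/ L)) (l %% L).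

Lemma mkseq_concat b r : (r <= L)%N ->
  mkseq concat (b * L + r) = mkseq concat (b * L) ++ take r (f b).
Proof.
move=> rL; rewrite /mkseq iotaD map_cat add0n; congr (_ ++ _).
apply: (@eq_from_nth _ j0); rewrite size_map size_iota ?size_takel ?size_f // => i ir.
have iL := leq_trans ir rL.
rewrite (nth_map 0%N) ?size_iota // nth_iota // nth_take // /concat.
by rewrite divnMDl // divn_small // addn0 modnMDl modn_small.
Qed.

Local Notation run := (run A C Q V obs).

Definition block_cost (X : 'M[R]_n) (w : seq I) : R :=
  \sum_(0 <= l < L) \tr (run X (take l w)).

Variables (P1 X : 'M[R]_n).
Hypotheses (P1_psd : possemidef P1) (X_psd : possemidef X) (P1X : loewner P1 X).
Hypothesis f_good : forall b, loewner (run X (f b)) X.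

Lemma block_start b : loewner (run P1 (mkseq concat (b * L))) X.
Proof.
elim: b => [//|b IH].
rewrite mulSn addnC mkseq_concat // take_oversize ?size_f // run_cat.
apply: (@loewner_trans _ _ (run X (f b))) => //.
by apply: run_mono => //; apply: run_psd.
Qed.

Lemma concat_cost b :
  \sum_(0 <= l < b * L) \tr (run P1 (mkseq concat l))
  <= \sum_(0 <= t < b) block_cost X (f t).
Proof.
rewrite big_nat_mul; apply: ler_sum => t _.
rewrite mulSn -[X in \sum_(X <= _ < _) _]add0n big_addn addnK.
rewrite /block_cost !big_mkord; apply: ler_sum => l _.
rewrite addnC mkseq_concat ?(ltnW (ltn_ord l)) // run_cat.
apply/loewner_tr/run_mono => //; last exact: block_start.
exact: run_psd.
Qed.

(** When the block costs average to m with an error of order the square root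
    of the number of blocks, the cost grows linearly in time at any rate above
    m / L. *)
Lemma concat_rate m D eta : 0 <= m -> 0 <= D -> 0 < eta ->
  (forall b, (\sum_(0 <= t < b) (block_cost X (f t) - m)) ^+ 2 <= b%:R * D) ->
  exists B, forall T, \sum_(0 <= l < T) \tr (run P1 (mkseq concat l))
     <= (m + eta) / L%:R * T%:R + B.
Proof.
move=> m0 D0 eta0 hD; exists (m + eta + D / eta) => T.
(* Traces are nonnegative, so the last block may be completed. *)
pose b := (T %/ L).+1.
have Tb : (T <= b * L)%N by rewrite ltnW // ltn_ceil.
have LR : 0 < (L%:R : R) by rewrite ltr0n.
apply: (@le_trans _ _ (\sum_(0 <= l < b * L) \tr (run P1 (mkseq concat l)))).
  rewrite [leRHS](big_cat_nat _ Tb) //= lerDl.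
  by apply: sumr_ge0 => l _; apply: tr_run_ge0.
apply: (le_trans (concat_cost b)).
set s := \sum_(0 <= t < b) _; set x : R := b%:R.
have x0 : 0 <= x by rewrite ler0n.
have hs : (s - x * m) ^+ 2 <= x * D.
  by have := hD b; rewrite sumrB sumr_const_nat subn0 -[m *+ b]mulr_natl.
have hs' : s - x * m <= x * eta + D / eta.
  have De0 : 0 <= D / eta by rewrite divr_ge0 // ltW.
  have xe0 : 0 <= x * eta by rewrite mulr_ge0 // ltW.
  have e : x * eta * (D / eta) = x * D by field; rewrite gt_eqF.
  (* Arithmetic-geometric mean inequality: sqrt (x D) is at most the sum. *)
  rewrite leNgt; apply/negP => h; set u := s - x * m in h hs *.
  nra.
have xT : x <= T%:R / L%:R + 1.
  rewrite /x /b -natr1 lerD2r ler_pdivlMr // -natrM ler_nat.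
  exact: leq_trunc_div.
have := ler_wpM2r (addr_ge0 m0 (ltW eta0)) xT.
rewrite mulrDl mul1r => h.
have -> : (m + eta) / L%:R * T%:R = T%:R / L%:R * (m + eta) by ring.
lra.
Qed.

End Blocks.

(** * Good blocks and the deterministic schedule *)

Lemma eventually_forall (I : finType) (P : I -> nat -> Prop) :
  (forall i, exists L0, forall L, (L0 <= L)%N -> P i L) ->
  exists L, (0 < L)%N /\ forall i, P i L.
Proof.
move=> /choice[f hf]; exists (\max_i f i).+1; split=> // i.
by apply: hf; rewrite ltnW // ltnS leq_bigmax.
Qed.

Lemma sum_eventually_le (R : realType) (u : nat -> R) alpha eps :
  0 <= alpha -> 0 < eps ->
  (exists l0, forall l, (l0 <= l)%N -> u l <= alpha) ->
  exists L0, forall L, (L0 <= L)%N -> \sum_(0 <= l < L) u l <= L%:R * (alpha + eps).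
Proof.
move=> a0 e0 [l0 hl]; pose B := \sum_(0 <= l < l0) u l.
have B0 : 0 <= `|B| / eps by rewrite divr_ge0 // ltW.
exists (maxn l0 (Num.bound (`|B| / eps))) => L; rewrite geq_max => /andP[lL hL].
have LB : `|B| <= L%:R * eps.
  rewrite -ler_pdivrMr //; apply: le_trans (ltW (archi_boundP B0)) _.
  by rewrite ler_nat.
rewrite (big_cat_nat _ lL) //= -/B mulrDr addrC lerD //; last first.
  exact: le_trans (ler_norm _) LB.
apply: (@le_trans _ _ (\sum_(l0 <= l < L) alpha)).
  by rewrite big_nat [leRHS]big_nat; apply: ler_sum => l /andP[? _]; apply: hl.
rewrite sumr_const_nat -[alpha *+ _]mulr_natl ler_wpM2r // ler_nat leq_subr //.
Qed.

Section ManySystems.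
Context {R : realType} {I : finType}.
Variables (n p : I -> nat) (A : forall i, 'M[R]_(n i)) (C : forall i, 'M[R]_(p i, n i)).
Variables (Q : forall i, 'M[R]_(n i)) (V : forall i, 'M[R]_(p i)).
Variables (S : forall i, 'M[R]_(n i)) (obs : I -> I -> bool).
Hypotheses (Q_posdef : forall i, posdef (Q i)) (V_posdef : forall i, posdef (V i)).
Hypothesis S_sqrt : forall i, is_sqrtmx (S i) (Q i).
Variables (q c : I -> R).
Hypotheses (q_ge0 : forall j, 0 <= q j) (q_sum1 : \sum_j q j = 1).

Local Notation run i := (run (A i) (C i) (Q i) (V i) (obs i)).

Hypothesis mean_le : forall i k, wmean q k (fun w => \tr (run i (Q i) w)) <= c i.

Let Q_psd i : possemidef (Q i) := posdef_psd (Q_posdef i).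

(** Words are admitted as blocks when they bring every system back below the
    multiple of Q from which it started; Markov's inequality shows that the
    other words have small total weight once that multiple is large. *)
Lemma good_blocks (P1 : forall i, 'M[R]_(n i)) eps :
  (forall i, possemidef (P1 i)) -> 0 < eps ->
  exists (L : nat) (G : seq (seq I)) (kappa : I -> R),
  [/\ (0 < L)%N, {in G, forall w, size w = L},
      forall i, 1 <= kappa i,
      forall i, loewner (P1 i) (kappa i *: Q i) &
      [/\ {in G, forall w i, loewner (run i (kappa i *: Q i) w) (kappa i *: Q i)},
      0 < \sum_(w <- G) \prod_(j <- w) q j &
      forall i, \sum_(w <- G) (\prod_(j <- w) q j) *
          block_cost (A i) (C i) (Q i) (V i) (obs i) L (kappa i *: Q i) w
        <= L%:R * (c i + eps) * \sum_(w <- G) \prod_(j <- w) q j]].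
Proof.
move=> P1_psd eps0.
have /choice[beta betaP] i : exists beta, 0 <= beta /\ forall P, possemidef P ->
    loewner P ((beta * \tr P) *: Q i).
  by have [b b0 hb] := posdef_dominates (Q_posdef i) (S_sqrt i); exists b.
have c_ge0 i : 0 <= c i by apply: mean_bound_ge0 (mean_le i).
pose e := eps / 3; have e0 : 0 < e by rewrite divr_gt0.
pose cs := \sum_i c i.
have cs_ge i : c i <= cs by rewrite /cs (bigD1 i) //= lerDl sumr_ge0.
have cs0 : 0 <= cs by apply: sumr_ge0.
(* The weight eta of the bad words is such that dividing by 1 - eta turns
   c i + 2 eps / 3 into at most c i + eps. *)
pose eta := e / (cs + eps).
have ceps : 0 < cs + eps by rewrite ltr_wpDl.
have eta0 : 0 < eta by rewrite divr_gt0.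
have etaE : eta * (cs + eps) = e by rewrite /eta; field; rewrite gt_eqF.
have eta1 : eta < 1 by rewrite /eta ltr_pdivrMr // mul1r /e; lra.
pose N : R := #|I|%:R.
have N0 : 0 <= N by rewrite ler0n.
(* The second term makes kappa i * Q i dominate P1 i, and the third one bounds
   by eta / N the probability that system i ends above kappa i * Q i. *)
pose kappa i := 1 + beta i * \tr (P1 i) + N * beta i * (c i + 1) / eta.
have t1 i : 0 <= beta i * \tr (P1 i).
  by rewrite mulr_ge0 ?psd_tr_ge0 //; have [] := betaP i.
have t2 i : 0 <= N * beta i * (c i + 1) / eta.
  have [b0 _] := betaP i.
  by rewrite divr_ge0 ?(ltW eta0) // !mulr_ge0 // addr_ge0.
have kappa1 i : 1 <= kappa i by have := t1 i; have := t2 i; rewrite /kappa; lra.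
have kappa_gt0 i : 0 < kappa i by apply: lt_le_trans (kappa1 i).
have X_psd i : possemidef (kappa i *: Q i) by apply/psd_scale => //; apply: ltW.
pose u i l := wmean q l (fun w => \tr (run i (kappa i *: Q i) w)).
have uP i d : 0 < d -> exists l0, forall l, (l0 <= l)%N -> u i l <= c i + d.
  move=> d0; have [b0 hb] := betaP i.
  exact: (mean_trace_run (Q_psd i) (V_posdef i) b0 hb).
have [L [L0 LP]] : exists L, (0 < L)%N /\ forall i,
    \sum_(0 <= l < L) u i l <= L%:R * (c i + e + e) /\ u i L <= c i + 1.
  apply: (@eventually_forall I (fun i L =>
    \sum_(0 <= l < L) u i l <= L%:R * (c i + e + e) /\ u i L <= c i + 1)) => i.
  have [L1 h1] := sum_eventually_le (addr_ge0 (c_ge0 i) (ltW e0)) e0 (uP i _ e0).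
  have [L2 h2] := uP i 1 ltr01.
  exists (maxn L1 L2) => L; rewrite geq_max => /andP[hL1 hL2].
  by split; [apply: h1|apply: h2].
(* This trace condition is sufficient for ending below kappa i * Q i. *)
pose good w := [forall i, beta i * \tr (run i (kappa i *: Q i) w) <= kappa i].
pose G := [seq w <- words L | good w].
have q0 w : 0 <= \prod_(j <- w) q j by apply: prodr_ge0.
set W := \sum_(w <- G) \prod_(j <- w) q j.
have We : 1 - eta <= W.
  rewrite /W big_filter big_mkcond /=.
  have -> : \sum_(w <- words L) (if good w then \prod_(j <- w) q j else 0)
     = wmean q L (fun w => (good w)%:R).
    by apply: eq_bigr => w _; case: (good w); rewrite ?mulr1 ?mulr0.
  (* Markov's inequality, summed over the systems. *)
  pose h w := \sum_i beta i / kappa i * \tr (run i (kappa i *: Q i) w).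
  apply: (@le_trans _ _ (wmean q L (fun w => 1 - h w))).
    rewrite wmeanB wmean_const // lerD2l lerN2 /h wmean_sum.
    apply: (@le_trans _ _ (\sum_(i : I) eta / N)).
      apply: ler_sum => i _; rewrite wmeanZ -/(u i L).
      have [_ uL] := LP i; have [b0 _] := betaP i.
      have Np : 0 < N by rewrite /N ltr0n; apply/card_gt0P; exists i.
      apply: (@le_trans _ _ (beta i / kappa i * (c i + 1))).
        by rewrite ler_wpM2l // divr_ge0 // ltW.
      rewrite mulrAC ler_pdivrMr // mulrAC ler_pdivlMr //.
      have : N * beta i * (c i + 1) / eta <= kappa i by have := t1 i; rewrite /kappa; lra.
      by rewrite ler_pdivrMr // => hk; rewrite mulrC mulrA [eta * _]mulrC.
    rewrite sumr_const -[X in X <= _]mulr_natl -/N.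
    have [->|Nn0] := eqVneq N 0; first by rewrite mul0r ltW.
    by rewrite mulrCA mulfV // mulr1.
  apply: wmean_le => // w _; rewrite /h.
  have hpos i : 0 <= beta i / kappa i * \tr (run i (kappa i *: Q i) w).
    have [b0 _] := betaP i.
    by rewrite mulr_ge0 ?divr_ge0 ?tr_run_ge0 // ltW.
  case: (boolP (good w)) => [_|]; first by rewrite gerBl sumr_ge0.
  rewrite negb_forall => /existsP[i]; rewrite -ltNge => hi.
  rewrite subr_le0 (bigD1 i) //= ler_wpDr ?sumr_ge0 //.
  by rewrite mulrAC ler_pdivlMr // mul1r ltW.
have W0 : 0 < W by apply: lt_le_trans We; rewrite subr_gt0.
exists L, G, kappa; split => //.
- by move=> w; rewrite mem_filter mem_words => /andP[_ /eqP].
- move=> i x; have [b0 hb] := betaP i.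
  apply: (le_trans (hb _ (P1_psd i) x)); rewrite !qformZ.
  rewrite ler_wpM2r ?psd_ge0 //; have := t2 i; rewrite /kappa; lra.
split => //.
- move=> w; rewrite mem_filter => /andP[/forallP hw _] i x.
  have [b0 hb] := betaP i.
  have hX : possemidef (run i (kappa i *: Q i) w) by apply: run_psd.
  apply: (le_trans (hb _ hX x)).
  by rewrite !qformZ ler_wpM2r ?psd_ge0.
- move=> i; apply: (@le_trans _ _ (L%:R * (c i + e + e))).
    have [uL _] := LP i; apply: le_trans uL.
    rewrite (_ : \sum_(0 <= l < L) u i l = wmean q L
      (block_cost (A i) (C i) (Q i) (V i) (obs i) L (kappa i *: Q i))).
      rewrite /G big_filter big_mkcond /=; apply: ler_sum => w _; case: ifP => // _.
      by rewrite mulr_ge0 // sumr_ge0 // => l _; apply: tr_run_ge0.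
    rewrite /block_cost wmean_sum; apply: eq_big_nat => l /andP[_ lL].
    by rewrite /u -(@wmean_take _ _ q q_sum1 l L) // ltnW.
  rewrite -mulrA ler_wpM2l ?ler0n //.
  apply: (@le_trans _ _ ((c i + eps) * (1 - eta))); last first.
    by rewrite ler_wpM2l // addr_ge0 ?c_ge0 // ltW.
  have := ler_wpM2l (ltW eta0) (cs_ge i).
  have : eps = 3 * e by rewrite /e; field.
  by nra.
Qed.

Lemma schedule_from_means (j0 : I) (P1 : forall i, 'M[R]_(n i)) eps :
  (forall i, possemidef (P1 i)) -> 0 < eps ->
  exists sel : nat -> I, forall i, exists B, forall T,
    \sum_(0 <= l < T) \tr (run i (P1 i) (mkseq sel l)) <= (c i + eps) * T%:R + B.
Proof.
move=> P1_psd eps0.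
have e0 : 0 < eps / 2 by rewrite divr_gt0.
have [L [G [kappa [L0 sizeG kappa1 P1le [goodG W0 costG]]]]] := good_blocks P1_psd e0.
set W := \sum_(w <- G) _ in W0 costG.
pose cost i := block_cost (A i) (C i) (Q i) (V i) (obs i) L (kappa i *: Q i).
have q0 w : 0 <= \prod_(j <- w) q j by apply: prodr_ge0.
have X_psd i : possemidef (kappa i *: Q i).
  by apply/psd_scale => //; apply: le_trans (kappa1 i).
have [f [D [D0 fG fD]]] := simultaneous_averaging cost (fun w _ => q0 w) W0.
exists (concat j0 f L) => i.
have LR : 0 < (L%:R : R) by rewrite ltr0n.
have eta0 : 0 < L%:R * (eps / 2) by rewrite mulr_gt0.
have m0 : 0 <= (\sum_(w <- G) (\prod_(j <- w) q j) * cost i w) / W.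
  rewrite divr_ge0 ?(ltW W0) // sumr_ge0 // => w _; rewrite mulr_ge0 // sumr_ge0 // => l _.
  by apply: tr_run_ge0.
have [B hB] := concat_rate (Q_psd i) (V_posdef i) j0 L0 (fun b => sizeG _ (fG b))
  (P1_psd i) (X_psd i) (P1le i) (fun b => goodG _ (fG b) i) m0 D0 eta0 (fD i).
exists B => T; apply: (le_trans (hB T)).
rewrite lerD2r ler_wpM2r // ler_pdivrMr //.
have : (\sum_(w <- G) (\prod_(j <- w) q j) * cost i w) / W <= L%:R * (c i + eps / 2).
  by rewrite ler_pdivrMr // costG.
move=> h; have -> : (c i + eps) * L%:R = L%:R * (c i + eps / 2) + L%:R * (eps / 2) by field.
by rewrite lerD2r.
Qed.

End ManySystems.

(** * Time averages and expectations *)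

Lemma limn_esup_le_rate (R : realType) (u : nat -> R) alpha B :
  (forall T, (0 < T)%N -> u T <= alpha + B / T%:R) ->
  (limn_esup (fun T => (u T)%:E) <= alpha%:E)%E.
Proof.
move=> hu; apply/lee_addgt0Pr => e e0; apply: ge_ereal_inf.
pose n0 := (Num.bound (`|B| / e)).+1.
exists (ereal_sup ((fun T => (u T)%:E) @` [set T | (n0 <= T)%N]%classic)).
  by exists [set T | (n0 <= T)%N]%classic => //; apply: nbhs_infty_ge.
apply: ge_ereal_sup => _ [T /= hT <-].
have T0 : (0 < T)%N by apply: leq_trans hT.
have TR : 0 < (T%:R : R) by rewrite ltr0n.
rewrite -EFinD lee_fin; apply: (le_trans (hu T T0)); rewrite lerD2l.
rewrite ler_pdivrMr // mulrC -ler_pdivrMr //.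
apply: (@le_trans _ _ (`|B| / e)).
  by rewrite ler_wpM2r ?invr_ge0 ?(ltW e0) // ler_norm.
have B0 : 0 <= `|B| / e by rewrite divr_ge0 // ltW.
apply: le_trans (ltW (archi_boundP B0)) _.
by rewrite ler_nat; apply: ltnW.
Qed.

Section Errcov.
Context {R : realType} {I : finType}.
Variables (n p : nat) (A : 'M[R]_n) (C : 'M[R]_(p, n)) (Q : 'M[R]_n) (V : 'M[R]_p).
Variables (pi0 : 'M[R]_n) (obs : I -> bool).

Local Notation P1 := (A *m pi0 *m A^T + Q).

Lemma errcov_run (xi : nat -> bool) (sel : nat -> I) k :
  (forall l, xi l.+1 = obs (sel l)) ->
  errcov A C Q V pi0 xi k.+1 = run A C Q V obs P1 (mkseq sel k).
Proof.
move=> xiE; elim: k => [//|k IH].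
by rewrite mkseqS run_rcons -IH -xiE.
Qed.

Lemma average_cost_le (xi : nat -> bool) (sel : nat -> I) alpha B :
  (forall l, xi l.+1 = obs (sel l)) ->
  (forall T, \sum_(0 <= l < T) \tr (run A C Q V obs P1 (mkseq sel l))
     <= alpha * T%:R + B) ->
  (average_cost A C Q V pi0 xi <= alpha%:E)%E.
Proof.
move=> xiE hB; apply: (@limn_esup_le_rate _ _ _ B) => T T0.
have TR : 0 < (T%:R : R) by rewrite ltr0n.
rewrite big_add1 succnK (eq_bigr (fun l => \tr (run A C Q V obs P1 (mkseq sel l)))); last first.
  by move=> l _; rewrite (errcov_run l xiE).
rewrite mulrC ler_pdivrMr // mulrDl divfK ?gt_eqF //; exact: hB.
Qed.

End Errcov.

Section RandomSelection.
Context {R : realType} {N : nat} {d : measure_display} {T : measurableType d}.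
Variables (P : probability T R) (q : 'I_N -> R) (xi : 'I_N -> nat -> {RV P >-> bool}).
Hypothesis xi_random : random_selection q xi.
Variable j0 : 'I_N.

(* Letters are numbered from 0 in a word, selection times from 1. *)
Definition word_event (w : seq 'I_N) : set T :=
  [set t | forall l, l \in iota 1 (size w) -> xi (nth j0 w l.-1) l t = true]%classic.

Lemma measurable_word_event w : measurable (word_event w).
Proof.
rewrite (_ : word_event w = \bigcap_(l in [set l | l \in iota 1 (size w)])
   (xi (nth j0 w l.-1) l @^-1` [set true]))%classic //.
apply: fin_bigcap_measurable; first exact: finite_seq.
by move=> l _; apply: measurable_funPTI.
Qed.

Lemma prob_word_event w : P (word_event w) = (\prod_(j <- w) q j)%:E.
Proof.
have [_ Pq indep] := xi_random.
have pos k : k \in iota 1 (size w) -> (0 < k)%N by rewrite mem_iota => /andP[].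
rewrite /word_event (indep _ (fun l => nth j0 w l.-1)) ?iota_uniq //.
have -> : \prod_(j <- w) q j = \prod_(l <- iota 1 (size w)) q (nth j0 w l.-1).
  by rewrite (iotaDl 1 0) big_map (big_nth j0) /index_iota subn0.
elim: (iota 1 (size w)) pos => [|l s IH] pos; first by rewrite !big_nil.
rewrite !big_cons IH => [|k ks]; last by apply: pos; rewrite inE ks orbT.
by rewrite Pq ?EFinM //; apply: pos; rewrite inE eqxx.
Qed.

Lemma selection_word t : exists sel : nat -> 'I_N,
  (forall i l, xi i l.+1 t = (i == sel l)) /\
  forall w, word_event w t <-> w = mkseq sel (size w).
Proof.
have [sched _ _] := xi_random.
have /choice[sel selP] l : exists j, forall i, xi i l.+1 t = (i == j).
  have := sched t l.+1 isT => h.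
  have /existsP[j hj] : [exists j, xi j l.+1 t].
    rewrite -[X in is_true X]negbK negb_exists; apply/negP => /forallP h0.
    by move: h; rewrite big1 // => i _; apply/eqP; rewrite eqb0 h0.
  exists j => i; have [->//|ij] := eqVneq i j.
  apply/negbTE/negP => hi; move: h.
  by rewrite (bigD1 j) //= (bigD1 i) //= hi hj.
exists sel; split => [i l|w]; first exact: selP.
split => [hw|->].
  apply: (@eq_from_nth _ j0); rewrite ?size_mkseq // => l lw.
  rewrite nth_mkseq //; apply/eqP; rewrite -selP.
  by apply: (hw l.+1); rewrite mem_iota add1n ltnS.
move=> l; rewrite size_mkseq mem_iota add1n; case: l => // l /= lw.
by rewrite nth_mkseq // selP eqxx.
Qed.

(** The word events of a given length partition the sample space, and their
    probabilities are the weights of the words. *)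
Lemma expectation_word (X : T -> R) (g : seq 'I_N -> R) k :
  (forall w, 0 <= g w) ->
  (forall t sel, (forall i l, xi i l.+1 t = (i == sel l)) -> X t = g (mkseq sel k)) ->
  ('E_P[X] = (wmean q k g)%:E)%E.
Proof.
move=> g0 Xg; rewrite unlock.
have -> : (fun t => (X t)%:E) =
    (fun t => \sum_(w <- words k) (g w)%:E * (\1_(word_event w) t)%:E)%E.
  apply/funext => t; have [sel [selP evP]] := selection_word t.
  rewrite (Xg t sel selP).
  have mk : mkseq sel k \in words k by rewrite mem_words size_mkseq.
  rewrite (bigD1_seq _ mk (uniq_words k)) /= indicE mem_set; last first.
    by apply/evP; rewrite size_mkseq.
  rewrite mule1 big_seq_cond big1 ?adde0 // => w; rewrite mem_words => /andP[/eqP wk wne].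
  rewrite indicE memNset ?mule0 // => /evP; rewrite wk => /eqP.
  by rewrite (negbTE wne).
have m1 w : measurable_fun setT (fun t => (\1_(word_event w) t : R)%:E).
  by apply/measurable_EFinP; apply/measurable_indic/measurable_word_event.
rewrite ge0_integral_sum //=; last 2 first.
- by move=> w; apply: measurable_funeM.
- by move=> w t _; rewrite mule_ge0 ?lee_fin.
rewrite /wmean -sumEFin; apply: eq_bigr => w _.
rewrite ge0_integralZl ?lee_fin //=.
rewrite integral_indic //; last exact: measurable_word_event.
by rewrite setIT /= prob_word_event -EFinM mulrC.
Qed.

Variables (n p : nat) (A : 'M[R]_n) (C : 'M[R]_(p, n)) (Q : 'M[R]_n) (V : 'M[R]_p).
Variables (pi0 : 'M[R]_n) (i : 'I_N).
Hypotheses (Q_psd : possemidef Q) (V_posdef : posdef V) (pi0_psd : possemidef pi0).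

Local Notation P1 := (A *m pi0 *m A^T + Q).
Local Notation runi := (run A C Q V (fun j => i == j)).

Lemma initial_psd : possemidef P1.
Proof.
split; last first.
  move=> x; change (0 <= qform P1 x).
  by rewrite qformD qform_congr addr_ge0 // psd_ge0.
rewrite [(_ + _)^T]raddfD /= !trmx_mul trmxK (proj1 pi0_psd) (proj1 Q_psd).
by rewrite mulmxA.
Qed.

Lemma initial_geQ : loewner Q P1.
Proof. by move=> x; rewrite qformD qform_congr lerDr psd_ge0. Qed.

Lemma tr_mean_errcov k :
  \tr (mean_errcov A C Q V pi0 (xi i) k.+1) = wmean q k (fun w => \tr (runi P1 w)).
Proof.
rewrite /mxtrace wmean_sum; apply: eq_bigr => a _; rewrite mxE.
rewrite (@expectation_word _ (fun w => runi P1 w a a) k) //.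
- by move=> w; apply/psd_diag_ge0/run_psd => //; apply: initial_psd.
- by move=> t sel selP; rewrite (@errcov_run _ _ _ _ _ _ _ _ _ (fun j => i == j) _ sel).
Qed.

(** Started at Q, the mean covariance increases with time, by invariance of
    the letters under shifts, and it stays below the one started at P1; hence
    it is bounded by the limit of the latter. *)
Lemma mean_trace_le_limit k : (forall j, 0 <= q j) -> \sum_j q j = 1 ->
  cvgn (mean_errcov A C Q V pi0 (xi i)) ->
  wmean q k (fun w => \tr (runi Q w)) <= \tr (limn (mean_errcov A C Q V pi0 (xi i))).
Proof.
move=> q0 q1 cv; set M := mean_errcov A C Q V pi0 (xi i) in cv *.
have trM : ((fun k => \tr (M k)) @ \oo --> \tr (limn M))%classic.
  apply: cvg_big => [|a _]; first exact: add_continuous.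
  exact: (continuous_cvg _ (@coord_continuous _ _ _ a a (limn M)) cv).
rewrite -(cvg_lim _ trM) //; apply: limr_ge; first by apply/cvg_ex; eexists; exact: trM.
exists k.+1 => // -[//|l] kl; have {}kl : (k <= l)%N := kl.
rewrite /M tr_mean_errcov -(subnK kl).
apply: (le_trans (mean_trace_cat A C (fun j => i == j) Q_psd V_posdef q0 q1 _ _)).
apply: wmean_le => // w _; apply/loewner_tr/run_mono => //.
- exact: initial_psd.
- exact: initial_geQ.
Qed.

End RandomSelection.

Unset Implicit Arguments.

(** * Comparison of the two optimal values *)

Theorem theorem1 (R : realType) (N : nat) (n p : 'I_N -> nat)
    (A : forall i : 'I_N, 'M[R]_(n i))
    (C : forall i : 'I_N, 'M[R]_(p i, n i))
    (Q : forall i : 'I_N, 'M[R]_(n i))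
    (Qsqrt : forall i : 'I_N, 'M[R]_(n i))
    (V : forall i : 'I_N, 'M[R]_(p i))
    (pi0 : forall i : 'I_N, 'M[R]_(n i))
    (N_ge1 : (1 <= N)%N)
    (Q_posdef : forall i : 'I_N, posdef (Q i))
    (V_posdef : forall i : 'I_N, posdef (V i))
    (pi0_possemidef : forall i : 'I_N, possemidef (pi0 i))
    (Qsqrt_sqrt : forall i : 'I_N, is_sqrtmx (Qsqrt i) (Q i))
    (AQ_controllable : forall i : 'I_N, controllable (A i) (Qsqrt i))
    (AC_detectable : forall i : 'I_N, detectable (A i) (C i))
    (A_invertible : forall i : 'I_N, A i \in unitmx) :
  (mu_d A C Q V pi0 <= mu_s A C Q V pi0)%E.
Proof.
apply: le_ereal_inf_tmp => _ [q [d [T [P [xi [q_sum q01 xi_random ->]]]]]].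
have q_ge0 i : 0 <= q i by have /andP[] := q01 i.
have Q_psd i := posdef_psd (Q_posdef i).
have j0 := Ordinal N_ge1.
pose cost i := limit_cost (A i) (C i) (Q i) (V i) (pi0 i) (xi i).
have le_max i : (cost i <= \big[maxe/-oo]_(i < N) cost i)%E by apply: le_bigmax.
(* If some expected covariance diverges, the stochastic cost is infinite. *)
have [[i cv]|cv] := pselect (exists i, ~ cvgn (mean_errcov (A i) (C i) (Q i) (V i) (pi0 i) (xi i))).
  suff -> : (\big[maxe/-oo]_(i < N) cost i = +oo)%E by rewrite leey.
  by apply/eqP; rewrite -leye_eq; apply: le_trans (le_max i); rewrite /cost /limit_cost asboolF.
have {}cv i : cvgn (mean_errcov (A i) (C i) (Q i) (V i) (pi0 i) (xi i)).
  by apply: contrapT => h; apply: cv; exists i.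
pose c i := \tr (limn (mean_errcov (A i) (C i) (Q i) (V i) (pi0 i) (xi i))).
have cE i : cost i = (c i)%:E by rewrite /cost /limit_cost asboolT.
have mean_le i k : wmean q k
    (fun w => \tr (run (A i) (C i) (Q i) (V i) (fun j => i == j) (Q i) w)) <= c i.
  exact: (mean_trace_le_limit xi_random j0).
apply/lee_addgt0Pr => eps eps0.
have P1_psd i := initial_psd (A i) (Q_psd i) (pi0_possemidef i).
have [sel selP] := schedule_from_means Q_posdef V_posdef Qsqrt_sqrt q_ge0 q_sum mean_le j0 P1_psd eps0.
(* P[k + 1] depends on the selections at times 1 to k, and letter l of sel is
   the selection at time l + 1. *)
pose eta i k := i == sel k.-1.
apply: ge_ereal_inf; exists (\big[maxe/-oo]_(i < N)
    average_cost (A i) (C i) (Q i) (V i) (pi0 i) (eta i))%E.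
  exists eta => // k _; rewrite (bigD1 (sel k.-1)) //= /eta eqxx big1 // => i.
  by move=> /negbTE ->.
apply: bigmax_le => [|i _]; first exact: leNye.
apply: (@le_trans _ _ (c i + eps)%:E).
  have [B hB] := selP i.
  exact: (@average_cost_le _ _ _ _ _ _ _ _ _ (fun j => i == j) _ sel _ B).
by rewrite EFinD leeD2r // -cE.
Qed.
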